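(* With the notation of the context: (i) The nonlinear operator $\hat N$ is contractive in the disc $\{\boldsymbol\delta:\|\boldsymbol\delta\|^{(1/2)}\le 1/158\}$; the contractivity factor is $<1/6$. (ii) For $\delta=g-g_0$ we have $$\|\delta-a_1J_1-a_2J_2\|<\frac1{1500},\qquad \|\delta'-a_1J_1'-a_2J_2'\|<\frac1{658},$$ where $\|\cdot\|$ is the sup norm on $[t_0,0]$. (iii) Let $a=\frac{87}{469}$ and $b=\frac{41}{134}$. Then $$|g(0)+a|<\frac1{167},\qquad |g'(0)-b|<\frac1{108}.$$
   Context: Tritronquée. With $x=\frac{e^{i\pi/4}}{30}(24z)^{5/4}$ and $y(z)=i\sqrt{z/6}\,\big(1-\frac{4}{25x^2}+h(x)\big)$, the equation $y''=6y^2+z$ becomes $h''+\frac1xh'-h=\frac{h^2}2+\frac{392}{625x^4}$. The tritronquée $y_t$ is the solution of $y''=6y^2+z$ corresponding to the unique $h$ with $h(x)=O(x^{-4})$ as $x\to+i\infty$ (i.e. $|z|\to\infty$, $\arg z=\pi/5$). Put $g(t)=e^{2\pi i/5}y_t(-te^{\pi i/5})$, which satisfies $g''=6g^2+t$ and is real-valued on the part of the negative real axis considered. Let $t_0=-1.7$. Quasi-solution. With $s=t-t_0$, $$g_0(t)=-\tfrac{280}{519}+\tfrac{150 s}{1013}+\tfrac{239s^2}{10331}+\tfrac{110s^3}{14779}-\tfrac{32s^4}{9853}+\tfrac{9s^5}{4397}-\tfrac{16s^6}{39505}+\tfrac{8s^7}{49105}.$$ Let $R=-(g_0''-6g_0^2-t)$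 and $\delta=g-g_0$, so $\delta''-12g_0\delta=6\delta^2+R$. Put $a_1=\delta(t_0)=g(t_0)-g_0(t_0)$ and $a_2=\delta'(t_0)=g'(t_0)-g_0'(t_0)$; these satisfy $|a_1|<\alpha_1:=1/290$ and $|a_2|<\alpha_2:=1/152$ (bounds coming from the analysis of $y_t$ on the ray $\arg z=\pi/5$, $|z|\ge1.7$). Approximate fundamental system. With $s=t-t_0$, $$J_1(t)=1-\tfrac{9489s^2}{2932}+\tfrac{1350s^3}{4721}+\tfrac{359s^4}{199}-\tfrac{1526s^5}{3719}-\tfrac{708s^6}{1633}+\tfrac{503s^7}{2201}-\tfrac{211s^8}{6486},$$ $$J_2(t)=s-\tfrac{48s^2}{659797}-\tfrac{2941s^3}{2730}+\tfrac{675s^4}{4873}+\tfrac{1832s^5}{4745}-\tfrac{2305s^6}{19401}-\tfrac{677s^7}{14054}+\tfrac{1573s^8}{53783}-\tfrac{531s^9}{128216}.$$ Let $W=J_1J_2'-J_2J_1'$, $A=\frac{J_2J_1''-J_1J_2''}{W}$, $B=\frac{J_2''J_1'-J_1''J_2'}{W}$, so that $J_1,J_2$ solve $f''+Af'+Bf=0$, and let $B_1=12g_0+B$. Operators. For $\sigma,t\in[t_0,0]$ let $\mathcal G(\sigma,t)=W(\sigma)^{-1}[J_2(t)J_1(\sigma)-J_1(t)J_2(\sigma)]$, $$K_1[f](t)=\int_{t_0}^t\mathcal G(\sigma,t)f(\sigma)\,d\sigma,\quad K_2[f](t)=\int_{t_0}^t\frac{\partial\mathcal G(\sigma,t)}{\partial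 t}f(\sigma)\,d\sigma,\quad \mathbf K[f]=(K_1[f],K_2[f]).$$ For a pair of continuous functions on $[t_0,0]$ written $\boldsymbol\delta=(\delta,\delta')$ (on general elements of the space the second component plays the role of the derivative), put $r(\boldsymbol\delta)=A\delta'+B_1\delta+6\delta^2$, and, with $\mathbf J_i=(J_i,J_i')$, $$\hat N\boldsymbol\delta=a_1\mathbf J_1+a_2\mathbf J_2+\mathbf K[R]+\mathbf K[r(\boldsymbol\delta)].$$ The equation for $\delta=g-g_0$ with its initial data at $t_0$ is equivalent to $\boldsymbol\delta=\hat N\boldsymbol\delta$ with $\boldsymbol\delta=(\delta,\delta')$. The norm is $\|\boldsymbol\delta\|^{(1/2)}=\max\{\|\delta\|,\frac12\|\delta'\|\}$, where $\|f\|$ is the sup norm on $[t_0,0]$. *)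

(* Defs.v *)
(* Stdlib real numbers with Coquelicot. *)
From Stdlib Require Import Reals.
From Coquelicot Require Import Coquelicot.

Open Scope R_scope.

Definition cis (theta : R) : C := (cos theta, sin theta).

(* Principal argument and principal power.  By the half-angle formula,
   [Carg z] is the argument in (-PI, PI) of every z off the half-line
   (-oo, 0]; only such z are used. *)
Definition Carg (z : C) : R := 2 * atan (Im z / (Cmod z + Re z)).

Definition Cpower (z : C) (p : R) : C :=
  (RtoC (Rpower (Cmod z) p) * cis (p * Carg z))%C.

(* The value of the total function [y] at a pole is irrelevant. *)
Definition is_pole (y : C -> C) (z0 : C) : Prop :=
  locally' z0 (fun z => ex_derive y z) /\
  filterlim (fun z => Cmod (y z)) (locally' z0) (Rbar_locally p_infty).

(* Meromorphic solutions on C of y'' = 6 y^2 + z (every solution of this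
   equation extends to one); derivatives are complex derivatives. *)
Definition P1_solution (y : C -> C) : Prop :=
  forall z0 : C,
    is_pole y z0 \/
    exists dy : C -> C,
      locally z0 (fun z => is_derive y z (dy z)) /\
      is_derive dy z0 (6 * (y z0) ^ 2 + z0)%C.

Definition x_of (z : C) : C :=
  (cis (PI / 4) / 30 * Cpower (24 * z) (5 / 4))%C.

(* On arg z = PI/5 the variable x = [x_of z] lies on the positive imaginary
   axis, so that |z| -> oo on this ray amounts to x -> +i oo. *)
Definition is_tritronquee (y : C -> C) : Prop :=
  P1_solution y /\
  exists h : C -> C,
    Rbar_locally p_infty (fun r =>
      let z := (RtoC r * cis (PI / 5))%C in
      let x := x_of z in
      y z = (Ci * Cpower (z / 6) (1 / 2) * (1 - 4 / (25 * x ^ 2) + h x))%C) /\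
    exists M : R,
      Rbar_locally p_infty (fun xi =>
        Cmod (h (Ci * RtoC xi)%C) <= M / xi ^ 4).

Definition ray (t : R) : C := (- RtoC t * cis (PI / 5))%C.

Definition gC (y : C -> C) (t : R) : C := (cis (2 * PI / 5) * y (ray t))%C.

Definition g (y : C -> C) (t : R) : R := Re (gC y t).

Definition t0 : R := - (17 / 10).

Definition g0 (t : R) : R :=
  let s := t - t0 in
  - (280 / 519) + 150 * s / 1013 + 239 * s ^ 2 / 10331 + 110 * s ^ 3 / 14779
  - 32 * s ^ 4 / 9853 + 9 * s ^ 5 / 4397 - 16 * s ^ 6 / 39505
  + 8 * s ^ 7 / 49105.

Definition residual (t : R) : R :=
  - (Derive_n g0 2 t - 6 * (g0 t) ^ 2 - t).

Definition J1 (t : R) : R :=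
  let s := t - t0 in
  1 - 9489 * s ^ 2 / 2932 + 1350 * s ^ 3 / 4721 + 359 * s ^ 4 / 199
  - 1526 * s ^ 5 / 3719 - 708 * s ^ 6 / 1633 + 503 * s ^ 7 / 2201
  - 211 * s ^ 8 / 6486.

Definition J2 (t : R) : R :=
  let s := t - t0 in
  s - 48 * s ^ 2 / 659797 - 2941 * s ^ 3 / 2730 + 675 * s ^ 4 / 4873
  + 1832 * s ^ 5 / 4745 - 2305 * s ^ 6 / 19401 - 677 * s ^ 7 / 14054
  + 1573 * s ^ 8 / 53783 - 531 * s ^ 9 / 128216.

Definition W (t : R) : R := J1 t * Derive J2 t - J2 t * Derive J1 t.

Definition A (t : R) : R :=
  (J2 t * Derive_n J1 2 t - J1 t * Derive_n J2 2 t) / W t.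

Definition B (t : R) : R :=
  (Derive_n J2 2 t * Derive J1 t - Derive_n J1 2 t * Derive J2 t) / W t.

Definition B1 (t : R) : R := 12 * g0 t + B t.

Definition G (sigma t : R) : R :=
  / W sigma * (J2 t * J1 sigma - J1 t * J2 sigma).

Definition K1 (f : R -> R) (t : R) : R :=
  RInt (fun sigma => G sigma t * f sigma) t0 t.

Definition K2 (f : R -> R) (t : R) : R :=
  RInt (fun sigma => Derive (fun tau => G sigma tau) t * f sigma) t0 t.

(* Elements of the function space are pairs of total functions of which only
   the restrictions to [t0, 0] matter. *)
Definition fpair : Type := ((R -> R) * (R -> R))%type.

Definition rhs (d : fpair) (t : R) : R :=
  A t * snd d t + B1 t * fst d t + 6 * (fst d t) ^ 2.

Definition Nhat (a1 a2 : R) (d : fpair) : fpair :=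
  (fun t => a1 * J1 t + a2 * J2 t + K1 residual t + K1 (rhs d) t,
   fun t => a1 * Derive J1 t + a2 * Derive J2 t
            + K2 residual t + K2 (rhs d) t).

Definition seg (t : R) : Prop := t0 <= t <= 0.

(* Meaningful for functions bounded on [t0, 0]: [real] sends +oo to 0. *)
Definition sup_norm (f : R -> R) : R :=
  real (Lub_Rbar (fun v => exists t : R, seg t /\ v = Rabs (f t))).

Definition half_norm (d : fpair) : R :=
  Rmax (sup_norm (fst d)) (1 / 2 * sup_norm (snd d)).

Definition fminus (d e : fpair) : fpair :=
  (fun t => fst d t - fst e t, fun t => snd d t - snd e t).

Definition half_disc (rho : R) (d : fpair) : Prop :=
  continuous_on seg (fst d) /\ continuous_on seg (snd d) /\
  half_norm d <= rho.

(* Main.v *)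
From Stdlib Require Import Reals Lra Lia Psatz List ZArith.
From Coquelicot Require Import Coquelicot.
(* Loaded last: the standard library also defines a constant [B1]. *)
Require Import Defs.
Import ListNotations.
Open Scope R_scope.

(* [J1], [J2] form an almost exact fundamental system, so [A], [B1] and the
   residual are tiny, and so is [A v + B1 u + 6 u^2] on the disc.  Since
   [J1^2 + 4 J2^2 <= 1.2^2] and [J1'^2 + 4 J2'^2 <= 2.5^2], Cauchy-Schwarz
   bounds the two kernels pointwise, which gives contractivity.  For the
   solution itself the same kernel bounds give the a posteriori estimate: as
   long as [g - g0] exists and lies in the closed disc, it lies strictly inside
   it.  A continuity argument in [t] then excludes poles on the whole segment,
   because near a first pole [g] would be unbounded. *)

(** * Polynomial inequalities on [t0, 0] *)

(** All data are rational polynomials in [t - t0]. After denominators are cleared, including a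
    factor [W] where it divides, almost every numerical claim becomes the nonnegativity of an
    integer polynomial on [0, 17/10], which exact computation can decide.

    The weight 4 reflects the shape of the fundamental system: [12 g0] runs from about -6.5 to -2.2,
    so [J1] and [J2] resemble cos(w s) and sin(w s)/w with w between 1.5 and 2.5, and w = 2 is a
    compromise for J1^2 + w^2 J2^2.

    The disc leaves little slack: the linear part may take up 0.0056 of the radius 1/158 =
    0.00632..., and the integral terms add up to 0.00048.

    A fixed point of [Nhat] would still have to be identified with [g], whose poles on the segment
    are not excluded beforehand. Estimating [g - g0] itself, as it is continued from [t0], settles
    regularity and size together. *)

Fixpoint zeval (p : list Z) (x : R) : R :=
  match p with
  | [] => 0
  | c :: q => IZR c + x * zeval q x
  end.

Fixpoint padd (p q : list Z) : list Z :=
  match p, q with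
  | [], _ => q
  | _, [] => p
  | a :: p', b :: q' => (a + b)%Z :: padd p' q'
  end.

Definition pscale (a : Z) (p : list Z) : list Z := map (Z.mul a) p.

Fixpoint pmul (p q : list Z) : list Z :=
  match p with
  | [] => []
  | a :: p' => padd (pscale a q) (0%Z :: pmul p' q)
  end.

Definition psub (p q : list Z) : list Z := padd p (pscale (-1) q).

Fixpoint pderiv (p : list Z) : list Z :=
  match p with
  | [] => []
  | _ :: q => padd q (0%Z :: pderiv q)
  end.

Fixpoint pshift1 (p : list Z) : list Z :=
  match p with
  | [] => []
  | c :: q => let q' := pshift1 q in padd (c :: q') q'
  end.

(** Substitution of [a * u / b] for the variable; the second component is the power of [b] that
    multiplies the result to keep its coefficients integral. *)
Fixpoint prescale (a b : Z) (p : list Z) : list Z * Z :=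
  match p with
  | [] => ([], 1%Z)
  | c :: q => let (q', k) := prescale a b q in
              ((c * k * b)%Z :: pscale a q', (k * b)%Z)
  end.

Fixpoint unit_minorant (p : list Z) : Z :=
  match p with
  | [] => 0%Z
  | c :: q => (c + Z.min 0 (unit_minorant q))%Z
  end.

(** [n] counts the cells after the first one, so [0, n + 1] is covered; each shift by 1 moves the
    next cell onto [0, 1]. *)
Fixpoint nonneg_cells (n : nat) (p : list Z) : bool :=
  (0 <=? unit_minorant p)%Z &&
  match n with
  | O => true
  | S m => nonneg_cells m (pshift1 p)
  end.

(* The substitution [s = 17 u / 640] cuts [0, 17/10] into 64 cells of unit length
   in [u]; on each one the Taylor coefficients are estimated Horner-fashion. *)
Definition nonneg_on_seg (p : list Z) : bool :=
  nonneg_cells 63 (fst (prescale 17 640 p)).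

Lemma zeval_padd (p q : list Z) (x : R) :
  zeval (padd p q) x = zeval p x + zeval q x.
Proof.
  revert q; induction p as [|a p IH]; intros [|b q]; simpl; try lra.
  rewrite plus_IZR, IH; ring.
Qed.

Lemma zeval_pscale (a : Z) (p : list Z) (x : R) :
  zeval (pscale a p) x = IZR a * zeval p x.
Proof.
  induction p as [|c p IH]; simpl; [ring|].
  fold (pscale a p); rewrite mult_IZR, IH; ring.
Qed.

Lemma zeval_psub (p q : list Z) (x : R) :
  zeval (psub p q) x = zeval p x - zeval q x.
Proof. unfold psub; rewrite zeval_padd, zeval_pscale; ring. Qed.

Lemma zeval_pmul (p q : list Z) (x : R) :
  zeval (pmul p q) x = zeval p x * zeval q x.
Proof.
  induction p as [|a p IH]; simpl; [ring|].
  rewrite zeval_padd, zeval_pscale; simpl; rewrite IH; ring.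
Qed.

Lemma is_derive_zeval (p : list Z) (x : R) :
  is_derive (zeval p) x (zeval (pderiv p) x).
Proof.
  induction p as [|a p IH]; simpl.
  - apply @is_derive_const.
  - rewrite zeval_padd; simpl.
    auto_derive; [now eexists; apply IH|].
    replace (Derive (fun x => zeval p x) x) with (zeval (pderiv p) x); [ring|].
    symmetry; apply is_derive_unique, IH.
Qed.

Lemma zeval_pshift1 (p : list Z) (x : R) :
  zeval (pshift1 p) x = zeval p (x + 1).
Proof.
  induction p as [|c p IH]; [reflexivity|].
  cbn [pshift1 zeval]; cbv zeta; rewrite zeval_padd; cbn [zeval].
  rewrite IH; ring.
Qed.

Lemma zeval_prescale (a b : Z) (p : list Z) (u : R) :
  (0 < b)%Z ->
  0 < IZR (snd (prescale a b p)) /\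
  zeval (fst (prescale a b p)) u =
    IZR (snd (prescale a b p)) * zeval p (IZR a * u / IZR b).
Proof.
  intros Hb; apply IZR_lt in Hb.
  induction p as [|c p [IH1 IH2]]; simpl; [lra|].
  destruct (prescale a b p) as [q k]; simpl in *.
  rewrite zeval_pscale, !mult_IZR, IH2; split.
  - now apply Rmult_lt_0_compat.
  - field; lra.
Qed.

(** For p = c + v q, a negative lower bound m of q gives v q >= m because v <= 1, and a nonnegative
    one gives v q >= 0. *)
Lemma unit_minorant_le (p : list Z) (v : R) :
  0 <= v <= 1 -> IZR (unit_minorant p) <= zeval p v.
Proof.
  intros Hv; induction p as [|c p IH]; simpl; [lra|].
  rewrite plus_IZR.
  destruct (Z.min_spec 0 (unit_minorant p)) as [[H ->]|[H ->]].
  - apply IZR_lt in H; nra.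
  - apply IZR_le in H; nra.
Qed.

Lemma nonneg_cells_correct (n : nat) (p : list Z) (u : R) :
  nonneg_cells n p = true -> 0 <= u <= INR n + 1 -> 0 <= zeval p u.
Proof.
  revert p u; induction n as [|n IH]; intros p u H Hu;
    apply Bool.andb_true_iff in H; destruct H as [H1 H2];
    apply Z.leb_le, IZR_le in H1.
  - simpl in Hu; generalize (unit_minorant_le p u); lra.
  - rewrite S_INR in Hu; destruct (Rle_dec u 1) as [Hu1|Hu1].
    + generalize (unit_minorant_le p u); lra.
    + replace u with ((u - 1) + 1) by ring.
      rewrite <- zeval_pshift1; apply IH; [exact H2|lra].
Qed.

Lemma nonneg_on_seg_correct (p : list Z) (t : R) :
  nonneg_on_seg p = true -> seg t -> 0 <= zeval p (t - t0).
Proof.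
  unfold seg, t0; intros H Ht.
  destruct (zeval_prescale 17 640 p ((t + 17 / 10) * 640 / 17)) as [Hk He];
    [lia|].
  replace (17 * ((t + 17 / 10) * 640 / 17) / 640) with (t - - (17 / 10)) in He
    by field.
  assert (Hn := nonneg_cells_correct 63 _ ((t + 17 / 10) * 640 / 17) H).
  rewrite He in Hn; simpl INR in Hn.
  apply Rmult_le_reg_l with (1 := Hk); rewrite Rmult_0_r; apply Hn; lra.
Qed.

(* [zeval ng (t - t0) / dg = g0 t], and similarly for [J1] and [J2], with all
   denominators cleared. *)
Definition dg : Z := 1349264020073592965590709393415.
Definition ng : list Z :=
  [-727926638960705260819650539800; 199792303071114456898920443250;
   31214219417054372159150086635; 10042563245692890331888357350;
   -4382061163336544696935217760; 2761741228260708821995993755;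
   -546468151403049929109007728; 219816966919636365435814584]%Z.
Definition d1 : Z := 73121351927991698076.
Definition n1 : list Z :=
  [73121351927991698076; 0; -236646830983872177027; 20909516014147170600;
   131912388654015173916; -30003544781423858904; -31702337516851268976;
   16710604279772750628; -2378755050386408926]%Z.
Definition d2 : Z := 9127033320807732785272032054840.
Definition n2 : list Z :=
  [0; 9127033320807732785272032054840; -663988468269439196742418560;
   -9832456042672359751459723909628; 1264261746674578212612070929000;
   3523861969171710529529686559424; -1084367393663307255814238126200;
   -439661417261052732007198356420; 266939802793272291825166064040;
   -37799141240944235578862614815]%Z.

Lemma dg_pos : 0 < IZR dg. Proof. apply IZR_lt; reflexivity. Qed.
Lemma d1_pos : 0 < IZR d1. Proof. apply IZR_lt; reflexivity. Qed.
Lemma d2_pos : 0 < IZR d2. Proof. apply IZR_lt; reflexivity. Qed.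

Lemma g0_zeval (t : R) : g0 t = zeval ng (t - t0) / IZR dg.
Proof. unfold g0, ng, dg, zeval; field. Qed.

Lemma J1_zeval (t : R) : J1 t = zeval n1 (t - t0) / IZR d1.
Proof. unfold J1, n1, d1, zeval; field. Qed.

Lemma J2_zeval (t : R) : J2 t = zeval n2 (t - t0) / IZR d2.
Proof. unfold J2, n2, d2, zeval; field. Qed.

Lemma is_derive_zeval_shift (p : list Z) (d t : R) :
  is_derive (fun t => zeval p (t - t0) / d) t (zeval (pderiv p) (t - t0) / d).
Proof.
  assert (H := is_derive_zeval p (t + - t0)).
  auto_derive; [now eexists; apply H|].
  replace (Derive (fun x => zeval p x) (t + - t0))
    with (zeval (pderiv p) (t + - t0)).
  - unfold Rminus, Rdiv; ring.
  - symmetry; apply is_derive_unique, H.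
Qed.

Lemma Derive_of_zeval (f : R -> R) (p : list Z) (d t : R) :
  (forall t, f t = zeval p (t - t0) / d) ->
  Derive f t = zeval (pderiv p) (t - t0) / d.
Proof.
  intros Hf; rewrite (Derive_ext _ _ _ Hf).
  apply is_derive_unique, is_derive_zeval_shift.
Qed.

Lemma ex_derive_of_zeval (f : R -> R) (p : list Z) (d t : R) :
  (forall t, f t = zeval p (t - t0) / d) -> ex_derive f t.
Proof.
  intros Hf; eexists.
  apply is_derive_ext with (f := fun t => zeval p (t - t0) / d);
    [intros; symmetry; apply Hf|apply is_derive_zeval_shift].
Qed.

Definition Derive_g0 (t : R) := Derive_of_zeval g0 ng (IZR dg) t g0_zeval.
Definition Derive_J1 (t : R) := Derive_of_zeval J1 n1 (IZR d1) t J1_zeval.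
Definition Derive_J2 (t : R) := Derive_of_zeval J2 n2 (IZR d2) t J2_zeval.
Definition Derive2_g0 (t : R) := Derive_of_zeval (Derive g0) _ _ t Derive_g0.
Definition Derive2_J1 (t : R) := Derive_of_zeval (Derive J1) _ _ t Derive_J1.
Definition Derive2_J2 (t : R) := Derive_of_zeval (Derive J2) _ _ t Derive_J2.

(* Numerators of [W], [B1 W] and [10 residual], with denominators [d1 d2],
   [d1 d2 dg] and [dg^2]. *)
Definition nW : list Z := psub (pmul n1 (pderiv n2)) (pmul n2 (pderiv n1)).

Definition nB : list Z :=
  padd (pscale 12 (pmul ng nW))
    (pscale dg (psub (pmul (pderiv (pderiv n2)) (pderiv n1))
                     (pmul (pderiv (pderiv n1)) (pderiv n2)))).

Definition nR : list Z :=
  psub (padd (pscale 60 (pmul ng ng)) (pscale (dg * dg) [-17; 10]%Z))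
    (pscale (10 * dg) (pderiv (pderiv ng))).

(** The caller supplies the goal as [p / k], with an integer polynomial [p] and a positive constant
    [k]; [field] checks this identity and computation over Z checks the sign of [p]. *)
Ltac by_cells p k :=
  lazymatch goal with
  | Ht : seg ?t |- 0 <= ?e =>
      replace e with (zeval p (t - t0) * / k);
      [ apply Rmult_le_pos;
        [ apply nonneg_on_seg_correct; [vm_compute; reflexivity | exact Ht]
        | left; apply Rinv_0_lt_compat;
          generalize dg_pos d1_pos d2_pos; intros;
          repeat apply Rmult_lt_0_compat; lra ]
      | generalize dg_pos d1_pos d2_pos; intros;
        cbn [Derive_n]; unfold W, nB, nR, nW;
        rewrite ?Derive2_J1, ?Derive2_J2, ?Derive2_g0, ?Derive_J1, ?Derive_J2,
          ?Derive_g0, ?J1_zeval, ?J2_zeval, ?g0_zeval;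
        repeat rewrite ?zeval_padd, ?zeval_psub, ?zeval_pscale, ?zeval_pmul;
        cbn [zeval]; rewrite ?mult_IZR; unfold t0; field; lra ]
  end.

(** * Numerical bounds for the approximate fundamental system *)

(** Such a bound is expected from Abel's formula W' = -A W with W(t0) = 1 and a tiny A; as [W] is a
    polynomial, the cells verify it directly. *)
Lemma W_lower (t : R) : seg t -> 999 / 1000 <= W t.
Proof.
  intros Ht; apply Rminus_le_0.
  by_cells (psub (pscale 1000 nW) (pscale 999 [d1 * d2]%Z))
           (1000 * IZR d1 * IZR d2).
Qed.

(** Cross-multiplication turns a bound on a rational function into two polynomial inequalities. *)
Lemma Rabs_div_le (a w c : R) :
  0 < w -> 0 <= c * w + a -> 0 <= c * w - a -> Rabs (a / w) <= c.
Proof.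
  intros Hw H1 H2; rewrite Rabs_div, (Rabs_pos_eq w) by lra.
  apply Rle_div_l; [exact Hw|]; apply Rabs_le; lra.
Qed.

Lemma A_bound (t : R) : seg t -> Rabs (A t) <= 8 / 10000.
Proof.
  intros Ht; generalize (W_lower t Ht); intros HW.
  apply Rabs_div_le; [lra| |].
  - by_cells (padd (pscale 8 nW) (pscale 10000
      (psub (pmul n2 (pderiv (pderiv n1))) (pmul n1 (pderiv (pderiv n2))))))
      (10000 * IZR d1 * IZR d2).
  - by_cells (psub (pscale 8 nW) (pscale 10000
      (psub (pmul n2 (pderiv (pderiv n1))) (pmul n1 (pderiv (pderiv n2))))))
      (10000 * IZR d1 * IZR d2).
Qed.

Lemma B1_bound (t : R) : seg t -> Rabs (B1 t) <= 21 / 10000.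
Proof.
  intros Ht; generalize (W_lower t Ht); intros HW.
  replace (B1 t) with ((12 * g0 t * W t + (Derive_n J2 2 t * Derive J1 t
    - Derive_n J1 2 t * Derive J2 t)) / W t) by (unfold B1, B; field; lra).
  apply Rabs_div_le; [lra| |].
  - by_cells (padd (pscale (21 * dg) nW) (pscale 10000 nB))
      (10000 * IZR d1 * IZR d2 * IZR dg).
  - by_cells (psub (pscale (21 * dg) nW) (pscale 10000 nB))
      (10000 * IZR d1 * IZR d2 * IZR dg).
Qed.

Lemma residual_bound (t : R) : seg t -> Rabs (residual t) <= 12 / 100000.
Proof.
  intros Ht; apply Rabs_le; split; apply Rminus_le_0; unfold residual.
  - by_cells (padd [12 * (dg * dg)]%Z (pscale 10000 nR))
      (100000 * IZR dg * IZR dg).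
  - by_cells (psub [12 * (dg * dg)]%Z (pscale 10000 nR))
      (100000 * IZR dg * IZR dg).
Qed.

Lemma energy_bound (t : R) : seg t -> J1 t ^ 2 + 4 * J2 t ^ 2 <= (12 / 10) ^ 2.
Proof.
  intros Ht; apply Rminus_le_0.
  by_cells (psub [36 * (d1 * d1 * (d2 * d2))]%Z (pscale 25
    (padd (pscale (d2 * d2) (pmul n1 n1)) (pscale (4 * (d1 * d1)) (pmul n2 n2)))))
    (25 * IZR d1 * IZR d1 * IZR d2 * IZR d2).
Qed.

Lemma energy_bound' (t : R) :
  seg t -> Derive J1 t ^ 2 + 4 * Derive J2 t ^ 2 <= (25 / 10) ^ 2.
Proof.
  intros Ht; apply Rminus_le_0.
  by_cells (psub [25 * (d1 * d1 * (d2 * d2))]%Z (pscale 4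
    (padd (pscale (d2 * d2) (pmul (pderiv n1) (pderiv n1)))
          (pscale (4 * (d1 * d1)) (pmul (pderiv n2) (pderiv n2))))))
    (4 * IZR d1 * IZR d1 * IZR d2 * IZR d2).
Qed.

(** The extreme value al1 |x| + al2 |y| is one of the four signed combinations, so the absolute
    values disappear and polynomial inequalities remain. *)
Lemma Rabs_combination_le (a1 a2 x y al1 al2 c : R) :
  Rabs a1 <= al1 -> Rabs a2 <= al2 ->
  0 <= c - (al1 * x + al2 * y) -> 0 <= c + (al1 * x + al2 * y) ->
  0 <= c - (al1 * x - al2 * y) -> 0 <= c + (al1 * x - al2 * y) ->
  Rabs (a1 * x + a2 * y) <= c.
Proof.
  intros H1 H2 Hc1 Hc2 Hc3 Hc4.
  apply Rle_trans with (al1 * Rabs x + al2 * Rabs y).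
  - eapply Rle_trans; [apply Rabs_triang|]; rewrite !Rabs_mult.
    generalize (Rabs_pos x) (Rabs_pos y); intros; nra.
  - unfold Rabs; do 2 destruct Rcase_abs; lra.
Qed.

(** The integer 44080 = 290 * 152 clears the denominators of the bounds on [a1] and [a2]. *)
Lemma linear_part_bound (a1 a2 t : R) :
  Rabs a1 <= 1 / 290 -> Rabs a2 <= 1 / 152 -> seg t ->
  Rabs (a1 * J1 t + a2 * J2 t) <= 56 / 10000.
Proof.
  intros H1 H2 Ht.
  apply (Rabs_combination_le _ _ _ _ _ _ _ H1 H2).
  - by_cells (psub [56 * (d1 * d2 * 44080)]%Z
      (padd (pscale (1520000 * d2) n1) (pscale (2900000 * d1) n2)))
      (440800000 * IZR d1 * IZR d2).
  - by_cells (padd [56 * (d1 * d2 * 44080)]%Z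
      (padd (pscale (1520000 * d2) n1) (pscale (2900000 * d1) n2)))
      (440800000 * IZR d1 * IZR d2).
  - by_cells (psub [56 * (d1 * d2 * 44080)]%Z
      (psub (pscale (1520000 * d2) n1) (pscale (2900000 * d1) n2)))
      (440800000 * IZR d1 * IZR d2).
  - by_cells (padd [56 * (d1 * d2 * 44080)]%Z
      (psub (pscale (1520000 * d2) n1) (pscale (2900000 * d1) n2)))
      (440800000 * IZR d1 * IZR d2).
Qed.

Lemma linear_part_bound' (a1 a2 t : R) :
  Rabs a1 <= 1 / 290 -> Rabs a2 <= 1 / 152 -> seg t ->
  Rabs (a1 * Derive J1 t + a2 * Derive J2 t) <= 112 / 10000.
Proof.
  intros H1 H2 Ht.
  apply (Rabs_combination_le _ _ _ _ _ _ _ H1 H2).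
  - by_cells (psub [112 * (d1 * d2 * 44080)]%Z
      (padd (pscale (1520000 * d2) (pderiv n1)) (pscale (2900000 * d1) (pderiv n2))))
      (440800000 * IZR d1 * IZR d2).
  - by_cells (padd [112 * (d1 * d2 * 44080)]%Z
      (padd (pscale (1520000 * d2) (pderiv n1)) (pscale (2900000 * d1) (pderiv n2))))
      (440800000 * IZR d1 * IZR d2).
  - by_cells (psub [112 * (d1 * d2 * 44080)]%Z
      (psub (pscale (1520000 * d2) (pderiv n1)) (pscale (2900000 * d1) (pderiv n2))))
      (440800000 * IZR d1 * IZR d2).
  - by_cells (padd [112 * (d1 * d2 * 44080)]%Z
      (psub (pscale (1520000 * d2) (pderiv n1)) (pscale (2900000 * d1) (pderiv n2))))
      (440800000 * IZR d1 * IZR d2).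
Qed.

Ltac eval_pderivs :=
  repeat match goal with
  | |- context [pderiv ?p] =>
      let q := eval vm_compute in (pderiv p) in change (pderiv p) with q
  end.

Lemma J_at_t0 :
  J1 t0 = 1 /\ J2 t0 = 0 /\ Derive J1 t0 = 0 /\ Derive J2 t0 = 1.
Proof.
  rewrite Derive_J1, Derive_J2, J1_zeval, J2_zeval.
  eval_pderivs; unfold Rminus; rewrite Rplus_opp_r.
  unfold n1, n2, d1, d2; cbn [zeval]; lra.
Qed.

(** The uniform bound 0.0056 plus the error 0.00048 would exceed 1/167, so the linear part is
    evaluated at the endpoint itself. The number -87/469 is a short rational approximation of
    [g0 0]. *)
Lemma end_bound (a1 a2 : R) :
  Rabs a1 <= 1 / 290 -> Rabs a2 <= 1 / 152 ->
  Rabs (a1 * J1 0 + a2 * J2 0) + Rabs (g0 0 + 87 / 469) <= 532 / 100000.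
Proof.
  intros H1 H2.
  assert (Rabs (g0 0 + 87 / 469) <= 2 / 1000000).
  { unfold g0, t0; apply Rabs_le; split; lra. }
  assert (Rabs (a1 * J1 0 + a2 * J2 0) <= 5308460 / 1000000000); [|lra].
  apply (Rabs_combination_le _ _ _ _ _ _ _ H1 H2); unfold J1, J2, t0; lra.
Qed.

Lemma end_bound' (a1 a2 : R) :
  Rabs a1 <= 1 / 290 -> Rabs a2 <= 1 / 152 ->
  Rabs (a1 * Derive J1 0 + a2 * Derive J2 0) + Rabs (Derive g0 0 - 41 / 134)
    <= 775 / 100000.
Proof.
  intros H1 H2.
  rewrite Derive_J1, Derive_J2, Derive_g0; eval_pderivs.
  unfold d1, d2, dg, t0; cbn [zeval].
  match goal with |- _ + Rabs ?e <= _ =>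
    assert (Rabs e <= 4 / 100000) by (apply Rabs_le; split; lra) end.
  match goal with |- Rabs ?e + _ <= _ =>
    assert (Rabs e <= 7695 / 1000000); [|lra] end.
  apply (Rabs_combination_le _ _ _ _ _ _ _ H1 H2); lra.
Qed.

(** * The operator Nhat *)

(** Lagrange's identity for (x, 2y) and (u, 2v): the product of the squared lengths is (x u + 4 y
    v)^2 + 4 (y u - x v)^2. *)
Lemma cross_product_bound (x y u v p q : R) :
  0 <= p -> 0 <= q ->
  x ^ 2 + 4 * y ^ 2 <= p ^ 2 -> u ^ 2 + 4 * v ^ 2 <= q ^ 2 ->
  Rabs (y * u - x * v) <= p * q / 2.
Proof.
  intros Hp Hq H1 H2.
  assert (Hpq : 0 <= p * q) by now apply Rmult_le_pos.
  rewrite <- (Rabs_pos_eq (p * q / 2)) by lra.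
  apply Rsqr_le_abs_0; unfold Rsqr.
  assert ((x ^ 2 + 4 * y ^ 2) * (u ^ 2 + 4 * v ^ 2) <= p ^ 2 * q ^ 2)
    by (apply Rmult_le_compat; nra).
  generalize (pow2_ge_0 (x * u + 4 * (y * v))); nra.
Qed.

(* With [(p, q) = (J2 t, J1 t)] this is [G sigma t], and with
   [(p, q) = (J2' t, J1' t)] it is the [t]-derivative of [G sigma t]. *)
Definition kern (p q sigma : R) : R := / W sigma * (p * J1 sigma - q * J2 sigma).

(** The constant is 1000/999 * 1.2 / 2 rounded up: the bound on 1/W times the Cauchy-Schwarz
    bound. *)
Lemma kern_bound (p q c sigma : R) :
  0 <= c -> q ^ 2 + 4 * p ^ 2 <= c ^ 2 -> seg sigma ->
  Rabs (kern p q sigma) <= 6006007 / 10000000 * c.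
Proof.
  intros Hc H Hs; unfold kern.
  generalize (W_lower _ Hs) (energy_bound _ Hs); intros HW HE.
  rewrite Rabs_mult, Rabs_inv, (Rabs_pos_eq (W sigma)) by lra.
  assert (H1 : / W sigma <= 1000 / 999)
    by (replace (1000 / 999) with (/ (999 / 1000)) by field;
        apply Rinv_le_contravar; lra).
  assert (H2 : 0 < / W sigma) by (apply Rinv_0_lt_compat; lra).
  assert (H3 := cross_product_bound q p (J1 sigma) (J2 sigma) c (12 / 10)
                  Hc ltac:(lra) H HE).
  generalize (Rabs_pos (p * J1 sigma - q * J2 sigma)); nra.
Qed.

Lemma kern_J_bound (sigma t : R) :
  seg sigma -> seg t -> Rabs (kern (J2 t) (J1 t) sigma) <= 73 / 100.
Proof.
  intros Hs Ht.
  generalize (kern_bound _ _ (12 / 10) _ ltac:(lra) (energy_bound t Ht) Hs); lra.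
Qed.

Lemma kern_J'_bound (sigma t : R) :
  seg sigma -> seg t ->
  Rabs (kern (Derive J2 t) (Derive J1 t) sigma) <= 151 / 100.
Proof.
  intros Hs Ht.
  generalize (kern_bound _ _ (25 / 10) _ ltac:(lra) (energy_bound' t Ht) Hs); lra.
Qed.

Lemma K1_kern (f : R -> R) (t : R) :
  K1 f t = RInt (fun s => kern (J2 t) (J1 t) s * f s) t0 t.
Proof. reflexivity. Qed.

Lemma ex_derive_J1 (t : R) : ex_derive J1 t.
Proof. exact (ex_derive_of_zeval _ _ _ t J1_zeval). Qed.

Lemma ex_derive_J2 (t : R) : ex_derive J2 t.
Proof. exact (ex_derive_of_zeval _ _ _ t J2_zeval). Qed.

Lemma K2_kern (f : R -> R) (t : R) :
  K2 f t = RInt (fun s => kern (Derive J2 t) (Derive J1 t) s * f s) t0 t.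
Proof.
  apply RInt_ext; intros s _; f_equal; unfold G, kern.
  apply is_derive_unique.
  generalize (ex_derive_J1 t) (ex_derive_J2 t); intros H1 H2.
  auto_derive; [tauto|].
  change (fun x => J1 x) with J1; change (fun x => J2 x) with J2; ring.
Qed.

(** * Continuity and integration on the segment *)

(** Composition with this retraction extends a function from the segment to the line by constants,
    so continuity there becomes ordinary continuity everywhere. *)
Definition clamp (x : R) : R := Rmax t0 (Rmin x 0).

(* Continuity of the restriction of [f] to [t0, 0]. *)
Definition seg_cont (f : R -> R) : Prop :=
  forall x, continuous (fun x => f (clamp x)) x.

Lemma clamp_seg (x : R) : seg (clamp x).
Proof.
  unfold seg, clamp, t0, Rmax, Rmin; repeat destruct Rle_dec; lra.
Qed.

Lemma clamp_id (x : R) : seg x -> clamp x = x.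
Proof.
  unfold seg, clamp, t0, Rmax, Rmin; repeat destruct Rle_dec; lra.
Qed.

Lemma continuous_clamp (x : R) : continuous clamp x.
Proof.
  (* The retraction is 1-Lipschitz, so [eps] serves as its own delta. *)
  apply filterlim_locally; intros eps; exists eps; intros z Hz.
  revert Hz; unfold ball; simpl; unfold AbsRing_ball, abs, minus, plus, opp; simpl.
  unfold clamp, t0, Rmax, Rmin, Rabs; repeat destruct Rle_dec;
    repeat destruct Rcase_abs; lra.
Qed.

Lemma seg_cont_of_continuous (f : R -> R) :
  (forall x, continuous f x) -> seg_cont f.
Proof.
  intros H x; apply (continuous_comp clamp f); [apply continuous_clamp|apply H].
Qed.

Lemma seg_cont_ext (f h : R -> R) :
  (forall t, seg t -> f t = h t) -> seg_cont f -> seg_cont h.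
Proof.
  intros H Hf x; eapply continuous_ext; [|apply (Hf x)].
  intros z; apply H, clamp_seg.
Qed.

Lemma seg_cont_const (c : R) : seg_cont (fun _ => c).
Proof. intros x; apply continuous_const. Qed.

Lemma seg_cont_plus (f h : R -> R) :
  seg_cont f -> seg_cont h -> seg_cont (fun t => f t + h t).
Proof. intros Hf Hh x; apply (continuous_plus _ _ _ (Hf x) (Hh x)). Qed.

Lemma seg_cont_minus (f h : R -> R) :
  seg_cont f -> seg_cont h -> seg_cont (fun t => f t - h t).
Proof. intros Hf Hh x; apply (continuous_minus _ _ _ (Hf x) (Hh x)). Qed.

Lemma seg_cont_mult (f h : R -> R) :
  seg_cont f -> seg_cont h -> seg_cont (fun t => f t * h t).
Proof. intros Hf Hh x; apply (continuous_mult _ _ _ (Hf x) (Hh x)). Qed.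

Lemma seg_cont_inv (f : R -> R) :
  seg_cont f -> (forall t, seg t -> f t <> 0) -> seg_cont (fun t => / f t).
Proof.
  intros Hf H0 x; apply (continuous_comp (fun x => f (clamp x)) Rinv);
    [apply Hf|].
  apply continuous_Rinv, H0, clamp_seg.
Qed.

Lemma continuous_on_seg_cont (f : R -> R) : continuous_on seg f <-> seg_cont f.
Proof.
  split; intros H x.
  - apply (filterlim_comp _ _ _ clamp f _ (within seg (locally (clamp x))));
      [|apply H, clamp_seg].
    intros P HP; apply (continuous_clamp x) in HP; unfold filtermap in *.
    refine (filter_imp _ _ _ HP); intros z Hz; apply Hz, clamp_seg.
  - intros Hx P HP; unfold filtermap, within.
    rewrite <- (clamp_id x Hx) in HP; apply (H x) in HP.
    unfold filtermap in HP; refine (filter_imp _ _ _ HP); intros z Hz Hz'.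
    now rewrite (clamp_id z Hz') in Hz.
Qed.

Lemma seg_cont_bounded (f : R -> R) :
  seg_cont f -> exists M, forall t, seg t -> Rabs (f t) <= M.
Proof.
  intros Hf.
  destruct (bounded_continuity (fun x => f (clamp x)) t0 0) as [M HM];
    [intros; apply Hf|].
  exists M; intros t Ht; specialize (HM t Ht); rewrite (clamp_id t Ht) in HM.
  now left.
Qed.

Lemma ex_RInt_seg_cont (f : R -> R) (t : R) :
  seg_cont f -> seg t -> ex_RInt f t0 t.
Proof.
  intros Hf Ht; apply ex_RInt_ext with (fun x => f (clamp x)).
  - intros x; rewrite Rmin_left, Rmax_right by apply Ht; intros Hx.
    rewrite clamp_id; [reflexivity|destruct Ht; unfold seg; lra].
  - apply (ex_RInt_continuous (V := R_CompleteNormedModule)); intros; apply Hf.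
Qed.

Lemma seg_cont_RInt (f : R -> R) :
  seg_cont f -> seg_cont (fun t => RInt f t0 t).
Proof.
  intros Hf.
  apply seg_cont_ext with (fun t => RInt (fun x => f (clamp x)) t0 t).
  - intros t Ht; apply RInt_ext.
    intros x; rewrite Rmin_left, Rmax_right by apply Ht; intros Hx.
    rewrite clamp_id; [reflexivity|destruct Ht; unfold seg; lra].
  - apply seg_cont_of_continuous; intros x.
    apply (continuous_RInt_1 (V := R_CompleteNormedModule)
             (fun x => f (clamp x)) t0 x
             (fun t => RInt (fun x => f (clamp x)) t0 t)).
    exists (mkposreal 1 Rlt_0_1); intros z _.
    apply (RInt_correct (V := R_CompleteNormedModule)).
    apply (ex_RInt_continuous (V := R_CompleteNormedModule)); intros; apply Hf.
Qed.

Lemma seg_cont_zeval (f : R -> R) (p : list Z) (d : R) :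
  (forall t, f t = zeval p (t - t0) / d) -> seg_cont f.
Proof.
  intros H; apply seg_cont_of_continuous; intros x.
  apply (ex_derive_continuous (V := R_NormedModule)).
  exact (ex_derive_of_zeval _ _ _ x H).
Qed.

Lemma seg_cont_J1 : seg_cont J1. Proof. exact (seg_cont_zeval _ _ _ J1_zeval). Qed.
Lemma seg_cont_J2 : seg_cont J2. Proof. exact (seg_cont_zeval _ _ _ J2_zeval). Qed.
Lemma seg_cont_g0 : seg_cont g0. Proof. exact (seg_cont_zeval _ _ _ g0_zeval). Qed.
Lemma seg_cont_J1' : seg_cont (Derive J1).
Proof. exact (seg_cont_zeval _ _ _ Derive_J1). Qed.
Lemma seg_cont_J2' : seg_cont (Derive J2).
Proof. exact (seg_cont_zeval _ _ _ Derive_J2). Qed.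
Lemma seg_cont_J1'' : seg_cont (Derive_n J1 2).
Proof. exact (seg_cont_zeval _ _ _ Derive2_J1). Qed.
Lemma seg_cont_J2'' : seg_cont (Derive_n J2 2).
Proof. exact (seg_cont_zeval _ _ _ Derive2_J2). Qed.
Lemma seg_cont_g0'' : seg_cont (Derive_n g0 2).
Proof. exact (seg_cont_zeval _ _ _ Derive2_g0). Qed.

Lemma seg_cont_W_inv : seg_cont (fun t => / W t).
Proof.
  apply seg_cont_inv.
  - unfold W; auto 10 using seg_cont_minus, seg_cont_mult, seg_cont_J1,
      seg_cont_J2, seg_cont_J1', seg_cont_J2'.
  - intros t Ht; generalize (W_lower t Ht); lra.
Qed.

Create HintDb segc.
#[local] Hint Resolve seg_cont_const seg_cont_plus seg_cont_minus seg_cont_mult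
  seg_cont_J1 seg_cont_J2 seg_cont_g0 seg_cont_J1' seg_cont_J2' seg_cont_J1''
  seg_cont_J2'' seg_cont_g0'' seg_cont_W_inv : segc.

Lemma seg_cont_A : seg_cont A.
Proof. unfold A, Rdiv; auto 10 with segc. Qed.

Lemma seg_cont_B1 : seg_cont B1.
Proof. unfold B1, B, Rdiv; auto 10 with segc. Qed.

Lemma seg_cont_id : seg_cont (fun t => t).
Proof. apply seg_cont_of_continuous; intros; apply continuous_id. Qed.

Lemma seg_cont_residual : seg_cont residual.
Proof.
  apply seg_cont_ext with
    (fun t => 0 - (Derive_n g0 2 t - 6 * (g0 t * g0 t) - t)).
  - intros; unfold residual; ring.
  - auto 10 using seg_cont_id with segc.
Qed.

Lemma seg_cont_rhs (d : fpair) :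
  seg_cont (fst d) -> seg_cont (snd d) -> seg_cont (rhs d).
Proof.
  intros H1 H2; apply seg_cont_ext with
    (fun t => A t * snd d t + B1 t * fst d t + 6 * (fst d t * fst d t)).
  - intros; unfold rhs; ring.
  - auto 10 using seg_cont_A, seg_cont_B1 with segc.
Qed.

Lemma seg_cont_kern (p q : R) : seg_cont (kern p q).
Proof. unfold kern; auto 10 with segc. Qed.

Lemma kern_RInt_bound (p q c F : R) (f : R -> R) (t : R) :
  (forall s, seg s -> Rabs (kern p q s) <= c) ->
  (forall s, seg s -> Rabs (f s) <= F) -> seg_cont f -> seg t ->
  Rabs (RInt (fun s => kern p q s * f s) t0 t) <= 17 / 10 * (c * F).
Proof.
  intros Hk HF Hf Ht.
  assert (H0 : 0 <= c * F).
  { apply Rmult_le_pos.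
    - eapply Rle_trans, (Hk t Ht); apply Rabs_pos.
    - eapply Rle_trans, (HF t Ht); apply Rabs_pos. }
  apply Rle_trans with ((t - t0) * (c * F)).
  - apply abs_RInt_le_const; [apply Ht| |].
    + apply ex_RInt_seg_cont; auto using seg_cont_kern with segc.
    + intros s Hs; assert (seg s) by (destruct Ht; unfold seg; lra).
      rewrite Rabs_mult; apply Rmult_le_compat; auto using Rabs_pos.
  - apply Rmult_le_compat_r; [exact H0|]; unfold seg, t0 in *; lra.
Qed.

Lemma kern_RInt_minus (p q : R) (f h : R -> R) (t : R) :
  seg_cont f -> seg_cont h -> seg t ->
  RInt (fun s => kern p q s * f s) t0 t - RInt (fun s => kern p q s * h s) t0 t
  = RInt (fun s => kern p q s * (f s - h s)) t0 t.
Proof.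
  intros Hf Hh Ht; symmetry.
  rewrite (RInt_ext _ (fun s => minus (kern p q s * f s) (kern p q s * h s)))
    by (intros; unfold minus, plus, opp; simpl; ring).
  apply (RInt_minus (V := R_CompleteNormedModule));
    apply ex_RInt_seg_cont; auto using seg_cont_kern with segc.
Qed.

(* The kernel is separable in [sigma] and [t], which reduces continuity in [t]
   to that of indefinite integrals. *)
Lemma seg_cont_kern_RInt (p q f : R -> R) :
  seg_cont p -> seg_cont q -> seg_cont f ->
  seg_cont (fun t => RInt (fun s => kern (p t) (q t) s * f s) t0 t).
Proof.
  intros Hp Hq Hf.
  assert (H1 : seg_cont (fun s => / W s * J1 s * f s)) by auto 10 with segc.
  assert (H2 : seg_cont (fun s => / W s * J2 s * f s)) by auto 10 with segc.
  apply seg_cont_ext with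
    (fun t => p t * RInt (fun s => / W s * J1 s * f s) t0 t
            - q t * RInt (fun s => / W s * J2 s * f s) t0 t);
    [|auto using seg_cont_RInt with segc].
  intros t Ht; symmetry.
  rewrite (RInt_ext _ (fun s => minus (scal (p t) (/ W s * J1 s * f s))
                                      (scal (q t) (/ W s * J2 s * f s))))
    by (intros; unfold kern, scal, minus, plus, opp; simpl;
        unfold mult; simpl; ring).
  rewrite (RInt_minus (V := R_CompleteNormedModule)),
    !(RInt_scal (V := R_CompleteNormedModule));
    auto using ex_RInt_seg_cont.
  all: apply (ex_RInt_scal (V := R_NormedModule)); auto using ex_RInt_seg_cont.
Qed.

(** * Norms, contraction and invariance of the disc *)

Lemma sup_norm_le (f : R -> R) (M : R) :
  (forall t, seg t -> Rabs (f t) <= M) -> sup_norm f <= M.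
Proof.
  intros H; unfold sup_norm.
  set (E := fun v => exists t, seg t /\ v = Rabs (f t)).
  destruct (Lub_Rbar_correct E) as [Hub Hlub].
  assert (H1 : Rbar_le (Lub_Rbar E) (Finite M)).
  { apply Hlub; intros v (t & Ht & ->); now apply H. }
  (* A member of the set excludes the supremum -oo, which [real] would turn into 0. *)
  assert (H2 : Rbar_le (Finite (Rabs (f (clamp 0)))) (Lub_Rbar E)).
  { apply Hub; exists (clamp 0); split; [apply clamp_seg|reflexivity]. }
  now destruct (Lub_Rbar E).
Qed.

(** Continuity on the compact segment makes the supremum finite; at +oo, [real] would return 0 and
    the inequality could fail. *)
Lemma Rabs_le_sup_norm (f : R -> R) (t : R) :
  seg_cont f -> seg t -> Rabs (f t) <= sup_norm f.
Proof.
  intros Hf Ht; unfold sup_norm.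
  destruct (seg_cont_bounded f Hf) as [M HM].
  set (E := fun v => exists t, seg t /\ v = Rabs (f t)).
  destruct (Lub_Rbar_correct E) as [Hub Hlub].
  assert (H1 : Rbar_le (Lub_Rbar E) (Finite M)).
  { apply Hlub; intros v (s & Hs & ->); now apply HM. }
  assert (H2 : Rbar_le (Finite (Rabs (f t))) (Lub_Rbar E)).
  { apply Hub; now exists t. }
  now destruct (Lub_Rbar E).
Qed.

Lemma half_norm_le (d : fpair) (c : R) :
  (forall t, seg t -> Rabs (fst d t) <= c) ->
  (forall t, seg t -> Rabs (snd d t) <= 2 * c) -> half_norm d <= c.
Proof.
  intros H1 H2; apply Rmax_lub; [now apply sup_norm_le|].
  generalize (sup_norm_le _ _ H2); lra.
Qed.

Lemma le_half_norm (d : fpair) (t : R) :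
  seg_cont (fst d) -> seg_cont (snd d) -> seg t ->
  Rabs (fst d t) <= half_norm d /\ Rabs (snd d t) <= 2 * half_norm d.
Proof.
  intros H1 H2 Ht; unfold half_norm.
  generalize (Rabs_le_sup_norm _ _ H1 Ht) (Rabs_le_sup_norm _ _ H2 Ht)
    (Rmax_l (sup_norm (fst d)) (1 / 2 * sup_norm (snd d)))
    (Rmax_r (sup_norm (fst d)) (1 / 2 * sup_norm (snd d))); lra.
Qed.

Lemma half_disc_seg_cont (rho : R) (d : fpair) :
  half_disc rho d -> seg_cont (fst d) /\ seg_cont (snd d).
Proof. intros (H1 & H2 & _); split; now apply continuous_on_seg_cont. Qed.

Lemma half_disc_bound (rho : R) (d : fpair) (t : R) :
  half_disc rho d -> seg t -> Rabs (fst d t) <= rho /\ Rabs (snd d t) <= 2 * rho.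
Proof.
  intros Hd Ht; destruct (half_disc_seg_cont _ _ Hd) as [H1 H2].
  generalize (le_half_norm d t H1 H2 Ht) (proj2 (proj2 Hd)); lra.
Qed.

(** Factoring the difference of squares gives 6 |u + w| <= 12/158 on the disc, for first components
    u and w; the linear terms give 37/10000 = 2 * 8/10000 + 21/10000. *)
Lemma rhs_diff_bound (d e : fpair) (h t : R) :
  seg t -> Rabs (fst d t) <= 1 / 158 -> Rabs (fst e t) <= 1 / 158 ->
  Rabs (fst d t - fst e t) <= h -> Rabs (snd d t - snd e t) <= 2 * h ->
  Rabs (rhs d t - rhs e t) <= (37 / 10000 + 12 / 158) * h.
Proof.
  intros Ht Hd He H1 H2; unfold rhs.
  replace (A t * snd d t + B1 t * fst d t + 6 * fst d t ^ 2
           - (A t * snd e t + B1 t * fst e t + 6 * fst e t ^ 2))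
    with (A t * (snd d t - snd e t) + B1 t * (fst d t - fst e t)
          + 6 * (fst d t + fst e t) * (fst d t - fst e t)) by ring.
  assert (Hs : Rabs (6 * (fst d t + fst e t)) <= 12 / 158).
  { rewrite Rabs_mult, (Rabs_pos_eq 6) by lra.
    generalize (Rabs_triang (fst d t) (fst e t)); lra. }
  apply Rle_trans with (8 / 10000 * (2 * h) + 21 / 10000 * h + 12 / 158 * h);
    [|lra].
  eapply Rle_trans; [apply Rabs_triang|]; apply Rplus_le_compat.
  eapply Rle_trans; [apply Rabs_triang|]; apply Rplus_le_compat.
  all: rewrite Rabs_mult; apply Rmult_le_compat;
    auto using Rabs_pos, A_bound, B1_bound.
Qed.

(** The quadratic term 6/158^2, about 0.00024, dominates; the residual adds 0.00012. *)
Lemma forcing_bound (d : fpair) (t : R) :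
  seg t -> Rabs (fst d t) <= 1 / 158 -> Rabs (snd d t) <= 2 / 158 ->
  Rabs (residual t + rhs d t) <= 3838 / 10000000.
Proof.
  intros Ht H1 H2.
  assert (Hr := Rabs_triang (residual t) (rhs d t)).
  assert (HR := residual_bound t Ht).
  enough (Rabs (rhs d t) <= 2638 / 10000000) by lra.
  unfold rhs.
  apply Rle_trans with
    (8 / 10000 * (2 / 158) + 21 / 10000 * (1 / 158) + 6 * (1 / 158) ^ 2); [|lra].
  eapply Rle_trans; [apply Rabs_triang|]; apply Rplus_le_compat.
  eapply Rle_trans; [apply Rabs_triang|]; apply Rplus_le_compat.
  - rewrite Rabs_mult; apply Rmult_le_compat; auto using Rabs_pos, A_bound.
  - rewrite Rabs_mult; apply Rmult_le_compat; auto using Rabs_pos, B1_bound.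
  - rewrite Rabs_mult, <- RPow_abs, (Rabs_pos_eq 6) by lra.
    apply Rmult_le_compat_l; [lra|].
    apply pow_incr; split; [apply Rabs_pos|exact H1].
Qed.

Lemma seg_cont_K1 (f : R -> R) : seg_cont f -> seg_cont (K1 f).
Proof.
  intros Hf; exact (seg_cont_kern_RInt J2 J1 f seg_cont_J2 seg_cont_J1 Hf).
Qed.

Lemma seg_cont_K2 (f : R -> R) : seg_cont f -> seg_cont (K2 f).
Proof.
  intros Hf; eapply seg_cont_ext;
    [|exact (seg_cont_kern_RInt _ _ f seg_cont_J2' seg_cont_J1' Hf)].
  intros; symmetry; apply K2_kern.
Qed.

Lemma K1_minus (f h : R -> R) (t : R) :
  seg_cont f -> seg_cont h -> seg t ->
  K1 f t - K1 h t = K1 (fun s => f s - h s) t.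
Proof. exact (kern_RInt_minus _ _ f h t). Qed.

Lemma K2_minus (f h : R -> R) (t : R) :
  seg_cont f -> seg_cont h -> seg t ->
  K2 f t - K2 h t = K2 (fun s => f s - h s) t.
Proof. rewrite !K2_kern; exact (kern_RInt_minus _ _ f h t). Qed.

(** The factor is the length of the segment times the kernel bound: 1.7 * 0.73, and below for [K2]
    1.7 * 1.51. *)
Lemma K1_bound (f : R -> R) (F t : R) :
  (forall s, seg s -> Rabs (f s) <= F) -> seg_cont f -> seg t ->
  Rabs (K1 f t) <= 1241 / 1000 * F.
Proof.
  intros HF Hf Ht; rewrite K1_kern.
  generalize (kern_RInt_bound _ _ _ _ f t
    (fun s Hs => kern_J_bound s t Hs Ht) HF Hf Ht); lra.
Qed.

Lemma K2_bound (f : R -> R) (F t : R) :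
  (forall s, seg s -> Rabs (f s) <= F) -> seg_cont f -> seg t ->
  Rabs (K2 f t) <= 2567 / 1000 * F.
Proof.
  intros HF Hf Ht; rewrite K2_kern.
  generalize (kern_RInt_bound _ _ _ _ f t
    (fun s Hs => kern_J'_bound s t Hs Ht) HF Hf Ht); lra.
Qed.

Lemma K1_plus (f h : R -> R) (t : R) :
  seg_cont f -> seg_cont h -> seg t ->
  K1 f t + K1 h t = K1 (fun s => f s + h s) t.
Proof.
  intros Hf Hh Ht.
  assert (H := K1_minus (fun s => f s + h s) h t ltac:(auto with segc) Hh Ht).
  cbv beta in H.
  replace (K1 (fun s => f s + h s - h s) t) with (K1 f t) in H; [lra|].
  apply RInt_ext; intros; apply (f_equal (Rmult _)); ring.
Qed.

Lemma K2_plus (f h : R -> R) (t : R) :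
  seg_cont f -> seg_cont h -> seg t ->
  K2 f t + K2 h t = K2 (fun s => f s + h s) t.
Proof.
  intros Hf Hh Ht.
  assert (H := K2_minus (fun s => f s + h s) h t ltac:(auto with segc) Hh Ht).
  cbv beta in H.
  replace (K2 (fun s => f s + h s - h s) t) with (K2 f t) in H; [lra|].
  apply RInt_ext; intros; apply (f_equal (Rmult _)); ring.
Qed.

(** The two budgets are 0.0056 + 1.241 * 0.0003838 < 1/158 and 0.0112 + 2.567 * 0.0003838 <
    2/158. *)
Lemma Nhat_maps_disc (a1 a2 : R) (d : fpair) :
  Rabs a1 <= 1 / 290 -> Rabs a2 <= 1 / 152 ->
  half_disc (1 / 158) d -> half_disc (1 / 158) (Nhat a1 a2 d).
Proof.
  intros Ha1 Ha2 Hd; destruct (half_disc_seg_cont _ _ Hd) as [H1 H2].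
  assert (Hr := seg_cont_rhs d H1 H2); assert (HR := seg_cont_residual).
  assert (HF : forall s, seg s ->
            Rabs (residual s + rhs d s) <= 3838 / 10000000).
  { intros s Hs; destruct (half_disc_bound _ _ s Hd Hs).
    apply forcing_bound; auto; lra. }
  split; [|split].
  - apply continuous_on_seg_cont; simpl; auto 10 using seg_cont_K1 with segc.
  - apply continuous_on_seg_cont; simpl; auto 10 using seg_cont_K2 with segc.
  - apply half_norm_le; simpl; intros t Ht.
    + rewrite Rplus_assoc, K1_plus by assumption.
      generalize (Rabs_triang (a1 * J1 t + a2 * J2 t)
        (K1 (fun s => residual s + rhs d s) t))
        (linear_part_bound a1 a2 t Ha1 Ha2 Ht)
        (K1_bound _ _ t HF ltac:(auto with segc) Ht); lra.
    + rewrite Rplus_assoc, K2_plus by assumption.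
      generalize (Rabs_triang (a1 * Derive J1 t + a2 * Derive J2 t)
        (K2 (fun s => residual s + rhs d s) t))
        (linear_part_bound' a1 a2 t Ha1 Ha2 Ht)
        (K2_bound _ _ t HF ltac:(auto with segc) Ht); lra.
Qed.

(** Only the [rhs] integrals survive in the difference. The Lipschitz constant, about 0.0797, is
    multiplied by 1.241 in the first component and by 2.567 / 2 in the weighted second one, both
    results below 0.11. *)
Lemma Nhat_contractive (a1 a2 : R) (d e : fpair) :
  half_disc (1 / 158) d -> half_disc (1 / 158) e ->
  half_norm (fminus (Nhat a1 a2 d) (Nhat a1 a2 e))
    <= 11 / 100 * half_norm (fminus d e).
Proof.
  intros Hd He.
  destruct (half_disc_seg_cont _ _ Hd) as [Hd1 Hd2].
  destruct (half_disc_seg_cont _ _ He) as [He1 He2].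
  set (h := half_norm (fminus d e)).
  assert (Hh : forall s, seg s ->
    Rabs (fst d s - fst e s) <= h /\ Rabs (snd d s - snd e s) <= 2 * h).
  { intros s Hs; apply (le_half_norm (fminus d e)); simpl; auto with segc. }
  assert (h_pos : 0 <= h).
  { destruct (Hh _ (clamp_seg 0)) as [H _].
    eapply Rle_trans, H; apply Rabs_pos. }
  assert (HF : forall s, seg s ->
    Rabs (rhs d s - rhs e s) <= (37 / 10000 + 12 / 158) * h).
  { intros s Hs; destruct (Hh s Hs).
    destruct (half_disc_bound _ _ s Hd Hs), (half_disc_bound _ _ s He Hs).
    now apply rhs_diff_bound. }
  assert (Hrd := seg_cont_rhs d Hd1 Hd2); assert (Hre := seg_cont_rhs e He1 He2).
  apply half_norm_le; simpl; intros t Ht.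
  - match goal with |- Rabs ?x <= _ => replace x with (K1 (rhs d) t - K1 (rhs e) t)
      by ring end.
    rewrite K1_minus by assumption.
    generalize (K1_bound _ _ t HF ltac:(auto with segc) Ht); lra.
  - match goal with |- Rabs ?x <= _ => replace x with (K2 (rhs d) t - K2 (rhs e) t)
      by ring end.
    rewrite K2_minus by assumption.
    generalize (K2_bound _ _ t HF ltac:(auto with segc) Ht); lra.
Qed.

(** * Variation of constants *)

(** Cramer's rule expresses (u, v) in the frame (j1, k1), (j2, k2); [q] and [p] weight the two
    coordinates. Their derivatives see only the defect of (u, v) in the linear equation that j1 and
    j2 satisfy exactly. *)
Lemma is_derive_variation (j1 k1 j2 k2 u v : R -> R) (l1 l2 f p q x : R) :
  is_derive j1 x (k1 x) -> is_derive k1 x l1 ->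
  is_derive j2 x (k2 x) -> is_derive k2 x l2 ->
  is_derive u x (v x) -> is_derive v x f ->
  let w x := j1 x * k2 x - j2 x * k1 x in
  w x <> 0 ->
  is_derive (fun x => (q * (k2 x * u x - j2 x * v x)
                       + p * (j1 x * v x - k1 x * u x)) / w x) x
    (/ w x * (p * j1 x - q * j2 x)
     * (f + (j2 x * l1 - j1 x * l2) / w x * v x
          + (l2 * k1 x - l1 * k2 x) / w x * u x)).
Proof.
  intros Hj1 Hk1 Hj2 Hk2 Hu Hv w Hw; unfold w in *.
  evar_last.
  - auto_derive; [|reflexivity].
    repeat split; try (eexists; eassumption); exact Hw.
  - repeat match goal with
    | |- context [Derive (fun y => ?h y) x] =>
        change (fun y => h y) with h;
        erewrite (is_derive_unique h x) by eassumption
    end.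
    field; exact Hw.
Qed.

Lemma is_derive_J1 (t : R) : is_derive J1 t (Derive J1 t).
Proof. apply Derive_correct, ex_derive_J1. Qed.

Lemma is_derive_J2 (t : R) : is_derive J2 t (Derive J2 t).
Proof. apply Derive_correct, ex_derive_J2. Qed.

Lemma is_derive_J1' (t : R) : is_derive (Derive J1) t (Derive_n J1 2 t).
Proof. apply Derive_correct; exact (ex_derive_of_zeval _ _ _ t Derive_J1). Qed.

Lemma is_derive_J2' (t : R) : is_derive (Derive J2) t (Derive_n J2 2 t).
Proof. apply Derive_correct; exact (ex_derive_of_zeval _ _ _ t Derive_J2). Qed.

(* Instead of rewriting the equation as an integral equation, the mean value
   theorem is applied to the combination [q c1 + p c2] of the varied constants
   in [u = c1 J1 + c2 J2], [v = c1 J1' + c2 J2']. *)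
Lemma variation_bound (u v : R -> R) (p q c T : R) :
  seg T ->
  (forall t, t0 <= t <= T -> is_derive u t (v t)) ->
  (forall t, t0 <= t <= T ->
     is_derive v t (12 * g0 t * u t + 6 * u t ^ 2 + residual t)) ->
  (forall t, t0 <= t <= T -> Rabs (u t) <= 1 / 158 /\ Rabs (v t) <= 2 / 158) ->
  (forall s, seg s -> Rabs (kern p q s) <= c) ->
  Rabs ((q * (Derive J2 T * u T - J2 T * v T)
         + p * (J1 T * v T - Derive J1 T * u T)) / W T
        - (q * u t0 + p * v t0)) <= 17 / 10 * (c * (3838 / 10000000)).
Proof.
  intros HT Hu Hv Hb Hk.
  set (phi := fun t => (q * (Derive J2 t * u t - J2 t * v t)
    + p * (J1 t * v t - Derive J1 t * u t)) / W t).
  assert (Hphi : forall t, t0 <= t <= T ->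
    is_derive phi t (kern p q t * (residual t + rhs (u, v) t))).
  { intros t Ht; assert (Hs : seg t) by (destruct HT; unfold seg; lra).
    generalize (W_lower t Hs); intros HW.
    evar_last.
    - apply is_derive_variation with (1 := is_derive_J1 t)
        (2 := is_derive_J1' t) (3 := is_derive_J2 t) (4 := is_derive_J2' t)
        (5 := Hu t Ht) (6 := Hv t Ht).
      unfold W in HW; lra.
    (* The term [12 g0 u] of the equation and [B u] of the defect combine into [B1 u]. *)
    - unfold kern, rhs, A, B1, B; simpl fst; simpl snd; fold (W t); field; lra. }
  assert (Hphi0 : phi t0 = q * u t0 + p * v t0).
  { unfold phi, W; destruct J_at_t0 as (-> & -> & -> & ->); field. }
  rewrite <- Hphi0.
  change (Rabs (phi T - phi t0) <= 17 / 10 * (c * (3838 / 10000000))).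
  destruct (MVT_gen phi t0 T (fun t => kern p q t * (residual t + rhs (u, v) t)))
    as (t & Ht & ->);
    rewrite ?Rmin_left, ?Rmax_right in * by apply HT.
  - intros t Ht; apply Hphi; lra.
  - intros t Ht; apply continuity_pt_filterlim.
    apply (ex_derive_continuous (V := R_NormedModule)); eexists; apply Hphi, Ht.
  - assert (Hs : seg t) by (destruct HT; unfold seg; lra).
    destruct (Hb t Ht) as [H1 H2].
    assert (H3 := forcing_bound (u, v) t Hs H1 H2).
    assert (H4 := Hk t Hs).
    rewrite !Rabs_mult, (Rabs_pos_eq (T - t0)) by (destruct HT; lra).
    rewrite Rmult_comm; apply Rmult_le_compat.
    + destruct HT; lra.
    + apply Rmult_le_pos; apply Rabs_pos.
    + unfold seg, t0 in HT; unfold t0; lra.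
    + apply Rmult_le_compat; auto using Rabs_pos.
Qed.

(** With [p], [q] equal to [J2 T], [J1 T], the combined coordinates at [T] reassemble [u T]; with
    the derivatives at [T] they reassemble [v T]. The kernel bounds fix this choice by
    unification. *)
Lemma a_posteriori_bound (u v : R -> R) (T : R) :
  seg T ->
  (forall t, t0 <= t <= T -> is_derive u t (v t)) ->
  (forall t, t0 <= t <= T ->
     is_derive v t (12 * g0 t * u t + 6 * u t ^ 2 + residual t)) ->
  (forall t, t0 <= t <= T -> Rabs (u t) <= 1 / 158 /\ Rabs (v t) <= 2 / 158) ->
  Rabs (u T - (u t0 * J1 T + v t0 * J2 T)) <= 48 / 100000 /\
  Rabs (v T - (u t0 * Derive J1 T + v t0 * Derive J2 T)) <= 99 / 100000.
Proof.
  intros HT Hu Hv Hb.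
  assert (HW := W_lower T HT).
  assert (H1 := variation_bound u v _ _ _ T HT Hu Hv Hb
                  (fun s Hs => kern_J_bound s T Hs HT)).
  assert (H2 := variation_bound u v _ _ _ T HT Hu Hv Hb
                  (fun s Hs => kern_J'_bound s T Hs HT)).
  split.
  - match type of H1 with Rabs ?x <= _ =>
      replace (u T - (u t0 * J1 T + v t0 * J2 T)) with x end; [lra|].
    unfold W in *; field; lra.
  - match type of H2 with Rabs ?x <= _ =>
      replace (v T - (u t0 * Derive J1 T + v t0 * Derive J2 T)) with x end; [lra|].
    unfold W in *; field; lra.
Qed.

(** * The solution along the ray *)

Lemma is_derive_C_approx (f : C -> C) (z l : C) (eps : R) :
  is_derive f z l -> 0 < eps ->
  exists delta, 0 < delta /\ forall w, Cmod (w - z) < delta ->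
    (Cmod (f w - f z - (w - z) * l)%C <= eps * Cmod (w - z)).
Proof.
  intros [_ H] Heps.
  destruct (H z (fun P HP => HP) (mkposreal eps Heps)) as [d Hd].
  exists d; split; [apply cond_pos|]; intros w Hw.
  exact (Hd w Hw).
Qed.

Lemma Re_le_Cmod (z : C) : Rabs (Re z) <= Cmod z.
Proof. eapply Rle_trans; [apply Rmax_l|apply Rmax_Cmod]. Qed.

Lemma cis_plus (a b : R) : (cis a * cis b)%C = cis (a + b).
Proof.
  unfold cis; rewrite cos_plus, sin_plus; unfold Cmult; simpl; f_equal; ring.
Qed.

Lemma Cmod_cis (a : R) : Cmod (cis a) = 1.
Proof.
  unfold Cmod, cis; simpl; transitivity (sqrt 1); [f_equal|apply sqrt_1].
  generalize (sin2_cos2 a); unfold Rsqr; lra.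
Qed.

Lemma ray_minus (u t : R) : (ray u - ray t)%C = (RtoC (t - u) * cis (PI / 5))%C.
Proof. unfold ray; rewrite RtoC_minus; ring. Qed.

Lemma Cmod_ray_minus (u t : R) : Cmod (ray u - ray t) = Rabs (u - t).
Proof.
  rewrite ray_minus, Cmod_mult, Cmod_cis, Cmod_R, Rabs_minus_sym; ring.
Qed.

Lemma ball_ray (u t eps : R) : Rabs (u - t) < eps -> ball (ray t) eps (ray u).
Proof.
  intros H; apply C_NormedModule_mixin_compat1.
  change (Cmod (ray u - ray t) < eps); now rewrite Cmod_ray_minus.
Qed.

Lemma locally_ray (P : C -> Prop) (t : R) :
  locally (ray t) P -> locally t (fun u => P (ray u)).
Proof.
  intros [eps H]; exists eps; intros u Hu; apply H, ball_ray, Hu.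
Qed.

(** Chain rule for the affine map [ray], of derivative -e^(i PI/5), passing from a complex
    derivative to a real one. *)
Lemma is_derive_ray (f : C -> C) (k l : C) (t : R) :
  is_derive f (ray t) l ->
  is_derive (fun u => Re (k * f (ray u))%C) t (Re (- (k * cis (PI / 5)) * l)%C).
Proof.
  intros Hf; apply is_derive_Reals; intros eps Heps.
  assert (Hk := Cmod_ge_0 k).
  (* The added 1 covers [k = 0] and makes the final inequality strict. *)
  assert (He : 0 < eps / (Cmod k + 1)) by (apply Rdiv_lt_0_compat; lra).
  destruct (is_derive_C_approx f _ l _ Hf He) as (d & Hd & H).
  exists (mkposreal d Hd); intros h Hh0 Hh; simpl in Hh.
  specialize (H (ray (t + h))); rewrite Cmod_ray_minus in H.
  replace (t + h - t) with h in H by ring; specialize (H Hh).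
  assert (Hh1 : 0 < Rabs h) by now apply Rabs_pos_lt.
  replace ((Re (k * f (ray (t + h))%C) - Re (k * f (ray t))%C) / h
           - Re (- (k * cis (PI / 5)) * l)%C)
    with (Re (k * (f (ray (t + h)) - f (ray t) - (ray (t + h) - ray t) * l))%C / h).
  - rewrite Rabs_div by exact Hh0; apply Rlt_div_l; [exact Hh1|].
    eapply Rle_lt_trans; [apply Re_le_Cmod|].
    rewrite Cmod_mult; eapply Rle_lt_trans;
      [apply Rmult_le_compat_l; [exact Hk|exact H]|].
    replace (Cmod k * (eps / (Cmod k + 1) * Rabs h))
      with (eps * Rabs h - eps / (Cmod k + 1) * Rabs h) by (field; lra).
    generalize (Rmult_lt_0_compat _ _ He Hh1); lra.
  - rewrite ray_minus; replace (t - (t + h)) with (- h) by ring.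
    destruct k as [k1 k2], (f (ray (t + h))) as [p1 p2], (f (ray t)) as [q1 q2],
      l as [l1 l2], (cis (PI / 5)) as [c1 c2].
    unfold Cmult, Cminus, Cplus, Copp, RtoC, Re; simpl; field; exact Hh0.
Qed.

(** Within distance [d], the linear approximation keeps |y| below |y z| + d (1 + |l|), while near a
    pole |y| exceeds this threshold; the point z + h with small real h > 0 is a witness. *)
Lemma is_derive_not_pole (y : C -> C) (z l : C) :
  is_derive y z l -> ~ is_pole y z.
Proof.
  intros Hd [_ Hp].
  destruct (is_derive_C_approx y z l 1 Hd Rlt_0_1) as (d & Hd0 & Hb).
  assert (Hlim := Hp (fun r => Cmod (y z) + d * (1 + Cmod l) < r)
                (ex_intro _ _ (fun r Hr => Hr))).
  destruct Hlim as [eps Heps].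
  set (h := Rmin (eps / 2) (d / 2)).
  assert (Hh : 0 < h /\ h < eps /\ h < d).
  { unfold h; generalize (cond_pos eps); intros; repeat split.
    - apply Rmin_glb_lt; lra.
    - eapply Rle_lt_trans; [apply Rmin_l|lra].
    - eapply Rle_lt_trans; [apply Rmin_r|lra]. }
  set (w := (z + RtoC h)%C).
  assert (Hw : Cmod (w - z) = h).
  { unfold w; replace (z + RtoC h - z)%C with (RtoC h) by ring.
    rewrite Cmod_R; apply Rabs_pos_eq; lra. }
  assert (H1 : Cmod (y z) + d * (1 + Cmod l) < Cmod (y w)).
  { apply Heps.
    - apply C_NormedModule_mixin_compat1; change (Cmod (w - z) < eps); lra.
    - intros E; rewrite E in Hw.
      replace (z - z)%C with (RtoC 0) in Hw by ring; rewrite Cmod_0 in Hw; lra. }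
  specialize (Hb w ltac:(lra)); rewrite Hw in Hb.
  assert (H2 : Cmod (y w) <= Cmod (y z)
                + (Cmod (y w - y z - (w - z) * l) + Cmod ((w - z) * l))).
  { replace (y w) with (y z + ((y w - y z - (w - z) * l) + (w - z) * l))%C at 1
      by ring.
    eapply Rle_trans; [apply Cmod_triangle|].
    apply Rplus_le_compat_l, Cmod_triangle. }
  rewrite Cmod_mult, Hw in H2; generalize (Cmod_ge_0 l); nra.
Qed.

Lemma not_pole_open (y : C -> C) (t : R) :
  P1_solution y -> ~ is_pole y (ray t) ->
  locally t (fun u => ~ is_pole y (ray u)).
Proof.
  intros Hy Ht; destruct (Hy (ray t)) as [Hp|(dy & Hdy & _)]; [easy|].
  apply (locally_ray (fun z => ~ is_pole y z)).
  refine (filter_imp _ _ _ Hdy); intros z; apply is_derive_not_pole.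
Qed.

(** With e = e^(i PI/5) and c = e^2 one has c^2 e = -1, so c e^2 (6 y^2 - t e) = 6 (c y)^2 + t. The
    real part stays outside the square until [gC] is known to be real. *)
Lemma g_derive (y : C -> C) (t : R) :
  P1_solution y -> ~ is_pole y (ray t) ->
  is_derive (g y) t (Derive (g y) t) /\
  is_derive (Derive (g y)) t (6 * Re (gC y t * gC y t)%C + t).
Proof.
  intros Hy Ht; destruct (Hy (ray t)) as [Hp|(dy & Hdy & Hddy)]; [easy|].
  set (c := cis (2 * PI / 5)); set (e := cis (PI / 5)).
  assert (Hg : locally t (fun u =>
            is_derive (g y) u (Re (- (c * e) * dy (ray u))%C))).
  { refine (filter_imp _ _ _ (locally_ray _ _ Hdy)); intros u Hu.
    apply is_derive_ray, Hu. }
  split.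
  - apply Derive_correct; eexists; exact (locally_singleton _ _ Hg).
  - apply (is_derive_ext_loc (fun u => Re (- (c * e) * dy (ray u))%C)).
    { refine (filter_imp _ _ _ Hg); intros u Hu.
      symmetry; apply is_derive_unique, Hu. }
    evar_last; [apply is_derive_ray, Hddy|].
    fold e.
    assert (Hce : (e * e)%C = c).
    { unfold e, c; rewrite cis_plus; f_equal; field. }
    assert (Hcc : (c * c * e)%C = (- RtoC 1)%C).
    { unfold e, c; rewrite !cis_plus.
      replace (2 * PI / 5 + 2 * PI / 5 + PI / 5) with PI by field.
      unfold cis; rewrite cos_PI, sin_PI; unfold Copp, RtoC; simpl; f_equal; ring. }
    replace (- (- (c * e) * e) * (6 * y (ray t) ^ 2 + ray t))%C
      with (6 * (gC y t * gC y t) + RtoC t)%C.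
    + unfold Re, Cplus, Cmult, RtoC; simpl; ring.
    + unfold gC; fold c; unfold ray; fold e; simpl Cpow.
      replace (- (- (c * e) * e))%C with (c * (e * e))%C by ring; rewrite Hce.
      set (Y := y (- RtoC t * e)%C).
      replace (c * c * (6 * (Y * (Y * 1)) + - t * e))%C
        with (6 * (c * Y * (c * Y)) + - t * (c * c * e))%C by ring.
      rewrite Hcc; ring.
Qed.

(** * Continuation from [t0] to 0 *)

(** Induction along an interval: the closed step reaches the supremum of the good initial segments,
    and the open step would pass beyond it if it were below [b]. *)
Lemma interval_induction (P : R -> Prop) (a b : R) :
  a <= b ->
  (forall m, a <= m <= b -> (forall u, a <= u < m -> P u) -> P m) ->
  (forall m, a <= m < b -> (forall u, a <= u <= m -> P u) -> locally m P) ->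
  forall u, a <= u <= b -> P u.
Proof.
  intros Hab Hclosed Hopen.
  set (E := fun T => a <= T <= b /\ forall u, a <= u <= T -> P u).
  assert (Ha : E a).
  (* At [m = a] the premise of the closed step is vacuous, which supplies the base case. *)
  { split; [lra|]; intros u Hu; apply Hclosed; [lra|]; intros; lra. }
  destruct (completeness E) as [m [Hub Hlub]].
  - exists b; intros T [HT _]; lra.
  - now exists a.
  - assert (Ham : a <= m) by now apply Hub.
    assert (Hmb : m <= b) by (apply Hlub; intros T [HT _]; lra).
    assert (Hlt : forall u, a <= u < m -> P u).
    { intros u Hu; apply Classical_Prop.NNPP; intros HnP.
      enough (m <= u) by lra; apply Hlub; intros T [HT HPT].
      apply Rnot_lt_le; intros Hlt; apply HnP, HPT; lra. }
    assert (Hle : forall u, a <= u <= m -> P u).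
    { intros u Hu; destruct (Req_dec u m) as [->|]; [|apply Hlt; lra].
      apply Hclosed; [lra|exact Hlt]. }
    destruct (Rle_lt_or_eq_dec _ _ Hmb) as [Hm| ->]; [|exact Hle].
    destruct (Hopen m (conj Ham Hm) Hle) as [eps Heps].
    assert (Heps0 := cond_pos eps).
    assert (HE : E (Rmin b (m + eps / 2))).
    { split; [split; [apply Rmin_glb; lra|apply Rmin_l]|].
      intros u Hu; destruct (Rle_dec u m); [apply Hle; lra|].
      apply Heps; generalize (Rmin_r b (m + eps / 2)); intros.
      change (Rabs (u - m) < eps); rewrite Rabs_pos_eq; lra. }
    apply Hub in HE; revert HE; unfold Rmin; destruct Rle_dec; lra.
Qed.

Lemma Rabs_le_left_limit (f : R -> R) (a m c : R) :
  a < m -> continuous f m -> (forall u, a <= u < m -> Rabs (f u) <= c) ->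
  Rabs (f m) <= c.
Proof.
  intros Ham Hf H; apply Rnot_lt_le; intros Hc.
  assert (Hloc : locally m (fun u => c < Rabs (f u))).
  { apply (continuous_comp f Rabs m Hf (continuous_Rabs (f m))).
    exists (mkposreal _ (proj2 (Rlt_0_minus _ _) Hc)); intros r Hr.
    revert Hr; unfold ball; simpl; unfold AbsRing_ball, abs, minus, plus, opp; simpl.
    unfold Rabs at 1; destruct Rcase_abs; lra. }
  destruct Hloc as [eps Heps]; assert (Heps0 := cond_pos eps).
  set (u := Rmax a (m - eps / 2)).
  assert (Hu : a <= u < m /\ m - eps < u).
  { unfold u, Rmax; destruct Rle_dec; lra. }
  assert (c < Rabs (f u)); [|generalize (H u (proj1 Hu)); lra].
  apply Heps; change (Rabs (u - m) < eps); rewrite Rabs_left; lra.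
Qed.

Lemma locally_Rabs_lt (f : R -> R) (m c : R) :
  continuous f m -> Rabs (f m) < c -> locally m (fun u => Rabs (f u) <= c).
Proof.
  intros Hf Hc.
  apply (continuous_comp f Rabs m Hf (continuous_Rabs (f m)) (fun r => r <= c)).
  exists (mkposreal _ (proj2 (Rlt_0_minus _ _) Hc)); intros r Hr.
  revert Hr; unfold ball; simpl; unfold AbsRing_ball, abs, minus, plus, opp; simpl.
  unfold Rabs at 1; destruct Rcase_abs; lra.
Qed.

(** A bound on one side along the ray suffices, since at a pole |y| tends to infinity along every
    approach. *)
Lemma bounded_not_pole (y : C -> C) (a m M : R) :
  a < m -> (forall u, a <= u < m -> Cmod (y (ray u)) <= M) ->
  ~ is_pole y (ray m).
Proof.
  intros Ham H [_ Hp].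
  destruct (Hp (fun r => M < r) (ex_intro _ M (fun r Hr => Hr))) as [eps Heps].
  assert (Heps0 := cond_pos eps).
  set (u := Rmax a (m - eps / 2)).
  assert (Hu : a <= u < m /\ m - eps < u).
  { unfold u, Rmax; destruct Rle_dec; lra. }
  assert (M < Cmod (y (ray u))); [|generalize (H u (proj1 Hu)); lra].
  apply Heps.
  - apply ball_ray; rewrite Rabs_left; lra.
  - intros E; assert (Hr := Cmod_ray_minus u m); rewrite E in Hr.
    replace (ray m - ray m)%C with (RtoC 0) in Hr by ring.
    rewrite Cmod_0, Rabs_left in Hr; lra.
Qed.

Lemma g0_derive (t : R) :
  is_derive g0 t (Derive g0 t) /\ is_derive (Derive g0) t (Derive_n g0 2 t).
Proof.
  split; apply Derive_correct.
  - exact (ex_derive_of_zeval _ _ _ t g0_zeval).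
  - exact (ex_derive_of_zeval _ _ _ t Derive_g0).
Qed.

(** A vanishing imaginary part turns Re(gC^2) into g^2; expanding 6 (g0 + delta)^2 then gives the
    equation for delta. *)
Lemma delta_derive (y : C -> C) (t : R) :
  P1_solution y -> ~ is_pole y (ray t) ->
  is_derive (fun t => g y t - g0 t) t (Derive (g y) t - Derive g0 t) /\
  (Im (gC y t) = 0 ->
   is_derive (fun t => Derive (g y) t - Derive g0 t) t
     (12 * g0 t * (g y t - g0 t) + 6 * (g y t - g0 t) ^ 2 + residual t)) /\
  ex_derive (fun t => Derive (g y) t - Derive g0 t) t.
Proof.
  intros Hy Ht; destruct (g_derive y t Hy Ht) as [H1 H2].
  destruct (g0_derive t) as [H3 H4].
  assert (H5 := is_derive_minus _ _ _ _ _ H2 H4).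
  split; [exact (is_derive_minus _ _ _ _ _ H1 H3)|].
  split; [|eexists; exact H5].
  intros Him; evar_last; [exact H5|].
  unfold residual, g; revert Him; destruct (gC y t) as [r i].
  unfold minus, plus, opp, Cmult, Re, Im; simpl; intros ->; ring.
Qed.

Section Continuation.

Variable y : C -> C.
Hypothesis Hy : P1_solution y.
Hypothesis Hreg : ~ is_pole y (ray t0).
Hypothesis Hreal : forall t, t0 <= t <= 0 -> ~ is_pole y (ray t) ->
  Im (gC y t) = 0.

Let u (t : R) : R := g y t - g0 t.
Let v (t : R) : R := Derive (g y) t - Derive g0 t.

Hypothesis Hu0 : Rabs (u t0) < 1 / 290.
Hypothesis Hv0 : Rabs (v t0) < 1 / 152.

Let controlled (t : R) : Prop :=
  ~ is_pole y (ray t) /\ Rabs (u t) <= 1 / 158 /\ Rabs (v t) <= 2 / 158.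

Lemma delta_continuous (t : R) :
  ~ is_pole y (ray t) -> continuous u t /\ continuous v t.
Proof.
  intros Ht; destruct (delta_derive y t Hy Ht) as (H1 & _ & H2).
  split; apply (ex_derive_continuous (V := R_NormedModule));
    [eexists; exact H1|exact H2].
Qed.

Lemma delta_a_posteriori (T : R) :
  seg T -> (forall t, t0 <= t <= T -> controlled t) ->
  Rabs (u T - (u t0 * J1 T + v t0 * J2 T)) <= 48 / 100000 /\
  Rabs (v T - (u t0 * Derive J1 T + v t0 * Derive J2 T)) <= 99 / 100000.
Proof.
  intros HT Hc; apply a_posteriori_bound; [exact HT| | |].
  - intros t Ht; exact (proj1 (delta_derive y t Hy (proj1 (Hc t Ht)))).
  - intros t Ht; assert (Hp := proj1 (Hc t Ht)).
    apply (delta_derive y t Hy Hp), Hreal; [unfold seg in HT; lra|exact Hp].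
  - intros t Ht; apply Hc, Ht.
Qed.

(** A bound on the real part [g] controls |y|, and hence excludes poles, because [gC] is real and
    the rotation has modulus 1. *)
Lemma Cmod_y_ray (t : R) :
  t0 <= t <= 0 -> ~ is_pole y (ray t) -> Cmod (y (ray t)) = Rabs (g y t).
Proof.
  intros Ht Hp; assert (Him := Hreal t Ht Hp).
  assert (H : Cmod (gC y t) = Cmod (y (ray t)))
    by (unfold gC; rewrite Cmod_mult, Cmod_cis; ring).
  rewrite <- H, <- Cmod_R; f_equal; unfold g.
  destruct (gC y t) as [a b]; simpl in Him |- *; now rewrite Him.
Qed.

Lemma controlled_closed (m : R) :
  t0 <= m <= 0 -> (forall t, t0 <= t < m -> controlled t) -> controlled m.
Proof.
  intros Hm Hc; destruct (Req_dec m t0) as [->|Hm0].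
  (* The initial bounds lie inside the disc: 1/290 < 1/158 and 1/152 < 2/158. *)
  { split; [exact Hreg|split; lra]. }
  destruct (seg_cont_bounded g0 seg_cont_g0) as [M HM].
  assert (Hp : ~ is_pole y (ray m)).
  { apply (bounded_not_pole y t0 m (M + 1 / 158)); [lra|]; intros t Ht.
    destruct (Hc t Ht) as (Hp & Hut & _).
    rewrite Cmod_y_ray by (lra || exact Hp).
    replace (g y t) with (g0 t + u t) by (unfold u; ring).
    assert (Hs : seg t) by (unfold seg; lra).
    generalize (Rabs_triang (g0 t) (u t)) (HM t Hs); lra. }
  destruct (delta_continuous m Hp) as [Huc Hvc].
  split; [exact Hp|split].
  - apply (Rabs_le_left_limit u t0); [lra|exact Huc|]; apply Hc.
  - apply (Rabs_le_left_limit v t0); [lra|exact Hvc|]; apply Hc.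
Qed.

(** The improved bounds 0.0056 + 0.00048 < 1/158 and 0.0112 + 0.00099 < 2/158 are strict, so by
    continuity the closed bounds persist near [m]. *)
Lemma controlled_open (m : R) :
  t0 <= m < 0 -> (forall t, t0 <= t <= m -> controlled t) -> locally m controlled.
Proof.
  intros Hm Hc; assert (Hs : seg m) by (unfold seg; lra).
  assert (Hp : ~ is_pole y (ray m)) by (apply Hc; lra).
  destruct (delta_a_posteriori m Hs Hc) as [H1 H2].
  assert (H3 := linear_part_bound (u t0) (v t0) m ltac:(lra) ltac:(lra) Hs).
  assert (H4 := linear_part_bound' (u t0) (v t0) m ltac:(lra) ltac:(lra) Hs).
  destruct (delta_continuous m Hp) as [Huc Hvc].
  repeat apply filter_and.
  - now apply not_pole_open.
  - apply locally_Rabs_lt; [exact Huc|].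
    generalize (Rabs_triang (u m - (u t0 * J1 m + v t0 * J2 m))
                  (u t0 * J1 m + v t0 * J2 m)).
    rewrite Rplus_comm, Rplus_minus; lra.
  - apply locally_Rabs_lt; [exact Hvc|].
    generalize (Rabs_triang (v m - (u t0 * Derive J1 m + v t0 * Derive J2 m))
                  (u t0 * Derive J1 m + v t0 * Derive J2 m)).
    rewrite Rplus_comm, Rplus_minus; lra.
Qed.

Lemma controlled_everywhere (t : R) : t0 <= t <= 0 -> controlled t.
Proof.
  apply interval_induction;
    [unfold t0; lra|exact controlled_closed|exact controlled_open].
Qed.

Lemma tritronquee_bounds (t : R) :
  t0 <= t <= 0 ->
  ~ is_pole y (ray t) /\
  Rabs (u t - (u t0 * J1 t + v t0 * J2 t)) <= 48 / 100000 /\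
  Rabs (v t - (u t0 * Derive J1 t + v t0 * Derive J2 t)) <= 99 / 100000.
Proof.
  intros Ht; split; [exact (proj1 (controlled_everywhere t Ht))|].
  apply delta_a_posteriori; [exact Ht|].
  intros s Hs; apply controlled_everywhere; lra.
Qed.

End Continuation.

Theorem proposition18 (y : C -> C) (a1 a2 : R)
  (Hy : is_tritronquee y)
  (Hreg : ~ is_pole y (ray t0))
  (Hreal : forall t : R, t0 <= t <= 0 -> ~ is_pole y (ray t) ->
     Im (gC y t) = 0)
  (Ha1 : a1 = g y t0 - g0 t0)
  (Ha2 : a2 = Derive (g y) t0 - Derive g0 t0)
  (Ha1_bound : Rabs a1 < 1 / 290)
  (Ha2_bound : Rabs a2 < 1 / 152) :
  ((forall d : fpair, half_disc (1 / 158) d -> half_disc (1 / 158) (Nhat a1 a2 d)) /\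
   (exists k : R, 0 <= k < 1 / 6 /\
      forall d e : fpair, half_disc (1 / 158) d -> half_disc (1 / 158) e ->
        half_norm (fminus (Nhat a1 a2 d) (Nhat a1 a2 e))
          <= k * half_norm (fminus d e))) /\
  ((forall t : R, t0 <= t <= 0 -> ~ is_pole y (ray t)) /\
   sup_norm (fun t => (g y t - g0 t) - a1 * J1 t - a2 * J2 t) < 1 / 1500 /\
   sup_norm (fun t => (Derive (g y) t - Derive g0 t)
                      - a1 * Derive J1 t - a2 * Derive J2 t) < 1 / 658) /\
  (Rabs (g y 0 + 87 / 469) < 1 / 167 /\
   Rabs (Derive (g y) 0 - 41 / 134) < 1 / 108).
Proof.
  assert (Hall : forall t, t0 <= t <= 0 ->
    ~ is_pole y (ray t) /\
    Rabs (g y t - g0 t - (a1 * J1 t + a2 * J2 t)) <= 48 / 100000 /\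
    Rabs (Derive (g y) t - Derive g0 t
          - (a1 * Derive J1 t + a2 * Derive J2 t)) <= 99 / 100000).
  { subst a1 a2; exact (tritronquee_bounds y (proj1 Hy) Hreg Hreal
                          Ha1_bound Ha2_bound). }
  assert (Hz : t0 <= 0 <= 0) by (unfold t0; lra).
  destruct (Hall 0 Hz) as (_ & H1 & H2).
  split; [|split].
  - split; [intros d; apply Nhat_maps_disc; lra|].
    exists (11 / 100); split; [lra|]; apply Nhat_contractive.
  - split; [intros t Ht; apply (Hall t Ht)|split].
    + apply Rle_lt_trans with (48 / 100000); [|lra].
      apply sup_norm_le; intros t Ht.
      rewrite <- Rminus_plus_distr; apply (Hall t Ht).
    + apply Rle_lt_trans with (99 / 100000); [|lra].
      apply sup_norm_le; intros t Ht.
      rewrite <- Rminus_plus_distr; apply (Hall t Ht).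
  (* The final sums are 0.00532 + 0.00048 < 1/167 and 0.00775 + 0.00099 < 1/108. *)
  - assert (H3 := end_bound a1 a2 ltac:(lra) ltac:(lra)).
    assert (H4 := end_bound' a1 a2 ltac:(lra) ltac:(lra)).
    split.
    + replace (g y 0 + 87 / 469)
        with ((g y 0 - g0 0 - (a1 * J1 0 + a2 * J2 0))
              + ((a1 * J1 0 + a2 * J2 0) + (g0 0 + 87 / 469))) by ring.
      eapply Rle_lt_trans; [apply Rabs_triang|].
      generalize (Rabs_triang (a1 * J1 0 + a2 * J2 0) (g0 0 + 87 / 469)); lra.
    + replace (Derive (g y) 0 - 41 / 134)
        with ((Derive (g y) 0 - Derive g0 0
               - (a1 * Derive J1 0 + a2 * Derive J2 0))
              + ((a1 * Derive J1 0 + a2 * Derive J2 0)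
                 + (Derive g0 0 - 41 / 134))) by ring.
      eapply Rle_lt_trans; [apply Rabs_triang|].
      generalize (Rabs_triang (a1 * Derive J1 0 + a2 * Derive J2 0)
                    (Derive g0 0 - 41 / 134)); lra.
Qed.
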